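(* Let $X$ be a random variable with probability density function $f$. Then, for any real-valued monotone, differentiable and invertible function $\zeta(x)$, $$I_\beta^\omega(\zeta(X))=\int_{\zeta^{-1}(0)}^{\zeta^{-1}(\infty)}\frac{\omega(\zeta(x))f^\beta(x)}{(\zeta'(x))^{\beta-1}}\,dx\quad\text{if }\zeta\text{ is strictly increasing,}$$ $$I_\beta^\omega(\zeta(X))=(-1)^{\beta-1}\int_{\zeta^{-1}(0)}^{\zeta^{-1}(\infty)}\frac{\omega(\zeta(x))f^\beta(x)}{(\zeta'(x))^{\beta-1}}\,dx\quad\text{if }\zeta\text{ is strictly decreasing.}$$
   Context: For a random variable $X$ with probability density function $f$, a weight (utility) function $\omega(x)\ge0$ and a real number $\beta\ge1$, the general weighted information generating function (GWIGF) of $X$ is $I_\beta^\omega(X)=\int_0^\infty \omega(u)f^\beta(u)\,du$, provided the integral exists. $I_\beta^\omega(\zeta(X))$ denotes the same quantity computed with the density of the transformed random variable $\zeta(X)$. Throughout, random variables are assumed to be non-negative and absolutely continuous, and the expectations, differentiations and integrations involved are assumed to exist. Here $\zeta'$ is the derivative and $\zeta^{-1}$ the inverse function of $\zeta$.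
   Formalization: For strictly decreasing ζ the integral is taken over the interval between ζ^{-1}(∞) and ζ^{-1}(0) without orientation, since read as oriented from ζ^{-1}(0) to ζ^{-1}(∞) the formula has the wrong sign (e.g. β=1, ω=1, ζ(x)=1/x); powers of negative numbers are principal values. *)

(* Defs.v *)
From HB Require Import structures.
From mathcomp Require Import all_boot all_order all_algebra.
From mathcomp Require Import all_classical all_reals all_analysis.
From mathcomp Require Export complex.
Set Implicit Arguments.
Unset Strict Implicit.
Unset Printing Implicit Defensive.
Import Order.TTheory GRing.Theory Num.Theory.
Import numFieldNormedType.Exports.
Local Open Scope classical_set_scope.
Local Open Scope ring_scope.
Local Open Scope complex_scope.

(* The identity includes the measurability of Y, so that it makes sense for a
   composition zeta \o X in which zeta is only controlled on a set carrying X. *)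
Definition has_density (d : measure_display) (T : measurableType d)
    (R : realType) (P : probability T R) (Y : T -> R) (f : R -> R) : Prop :=
  [/\ measurable_fun [set: T] Y,
      measurable_fun [set: R] f,
      forall x, 0 <= f x &
      forall A : set R, measurable A ->
        P (Y @^-1` A) = (\int[lebesgue_measure]_(x in A) (f x)%:E)%E].

Definition gwigf_exists (R : realType) (omega : R -> R) (beta : R)
    (f : R -> R) : Prop :=
  lebesgue_measure.-integrable `[0, +oo[
    (fun u => (omega u * f u `^ beta)%:E).

(* GWIGF of a random variable with density f; changing f on a null set does
   not change it. *)
Definition gwigf (R : realType) (omega : R -> R) (beta : R) (f : R -> R) : R :=
  \int[lebesgue_measure]_(u in `[0, +oo[) (omega u * f u `^ beta).

(* Inverse of a strictly increasing function zeta on the interval J, extended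
   to every y in [-oo, +oo]: it is the usual inverse at the points of the image
   (inv_incrK), and for y below or above the image it is the lower or the upper
   end of J; e.g. the value at +oo is the end of J at which zeta tends to +oo
   when zeta is unbounded above. *)
Definition inv_incr (R : realType) (J : set R) (zeta : R -> R) (y : \bar R) :
    \bar R :=
  ereal_sup ([set ereal_inf (EFin @` J)] `|`
             EFin @` [set x | J x /\ ((zeta x)%:E <= y)%E]).

(* The same for a strictly decreasing function. *)
Definition inv_decr (R : realType) (J : set R) (zeta : R -> R) (y : \bar R) :
    \bar R :=
  ereal_sup ([set ereal_inf (EFin @` J)] `|`
             EFin @` [set x | J x /\ (y <= (zeta x)%:E)%E]).

Lemma inv_incrK (R : realType) (J : set R) (zeta : R -> R) (x : R) :
  (forall s t, J s -> J t -> s < t -> zeta s < zeta t) ->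
  J x -> inv_incr J zeta (zeta x)%:E = x%:E.
Proof.
move=> zI Jx; apply/eqP; rewrite eq_le; apply/andP; split.
- apply: ge_ereal_sup => z [->|[t [Jt]]].
    by apply: ereal_inf_lbound; exists x.
  rewrite lee_fin => zt <-; rewrite lee_fin leNgt.
  by apply/negP => /(zI _ _ Jx Jt); rewrite ltNge zt.
- by apply: ereal_sup_ubound; right; exists x.
Qed.

Lemma inv_decrK (R : realType) (J : set R) (zeta : R -> R) (x : R) :
  (forall s t, J s -> J t -> s < t -> zeta t < zeta s) ->
  J x -> inv_decr J zeta (zeta x)%:E = x%:E.
Proof.
move=> zD Jx; apply/eqP; rewrite eq_le; apply/andP; split.
- apply: ge_ereal_sup => z [->|[t [Jt]]].
    by apply: ereal_inf_lbound; exists x.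
  rewrite lee_fin => zt <-; rewrite lee_fin leNgt.
  by apply/negP => /(zD _ _ Jx Jt); rewrite ltNge zt.
- by apply: ereal_sup_ubound; right; exists x.
Qed.

(* The interval with ends a and b, in either order: a decreasing zeta has
   zeta^-1(+oo) <= zeta^-1(0), and the formula with the factor
   (-1)^(beta - 1) is the one for the integral over this interval (an integral
   oriented from zeta^-1(0) to zeta^-1(+oo) would have the opposite sign, as
   beta = 1 shows). *)
Definition between (R : realType) (a b : \bar R) : set R :=
  [set x | (mine a b < x%:E < maxe a b)%E].

(* Principal value exp(a * Log x) of the power x ^ a for real x and a, with
   Arg x = pi when x < 0. *)
Definition cpow (R : realType) (x a : R) : R[i] :=
  (`|x| `^ a)%:C *
  (if x < 0 then cos (a * pi) +i* sin (a * pi) else 1).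

Definition cintegral (R : realType) (D : set R) (h : R -> R[i]) : R[i] :=
  (\int[lebesgue_measure]_(x in D) complex.Re (h x)) +i*
  (\int[lebesgue_measure]_(x in D) complex.Im (h x)).

(* Sanity check: natural exponents give the usual powers. *)
Lemma cpow_nat (R : realType) (x : R) (n : nat) : cpow x n%:R = x%:C ^+ n.
Proof.
rewrite /cpow powR_mulrn//.
have sn m : sin (m%:R * pi : R) = 0.
  elim: m => [|m IH]; first by rewrite mul0r sin0.
  by rewrite -natr1 mulrDl mul1r sinDpi IH oppr0.
have cn m : cos (m%:R * pi : R) = (-1) ^+ m.
  elim: m => [|m IH]; first by rewrite mul0r cos0.
  by rewrite -natr1 mulrDl mul1r cosDpi IH exprS mulN1r.
rewrite sn cn; case: ltrP => x0; last by rewrite mulr1 ger0_norm// rmorphXn.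
rewrite -[_ +i* 0]/(((-1) ^+ n)%:C) -rmorphM/= -exprMn mulrN1.
by rewrite ltr0_norm// opprK rmorphXn.
Qed.

(* Main.v *)
(* No change of variables in the integral is needed, so zeta need not be C^1.
   Put Z = zeta(X).  Since g is the density of Z,
     int omega g^beta = E[omega(Z) g(Z)^(beta-1)],
   and likewise the right-hand side is
     E[omega(zeta(X)) (f(X)/|zeta'(X)|)^(beta-1)].
   By Lebesgue's differentiation theorem the distribution functions F of X and
   G of Z are almost surely differentiable at X and Z, with derivatives f(X) and
   g(Z).  As F = G o zeta on J (or 1 - G o zeta when zeta decreases), the chain
   rule gives f(X) = g(Z) |zeta'(X)| almost surely, and f(X) > 0 almost surely
   rules out the points where zeta' vanishes. *)
From HB Require Import structures.
Require Import Defs.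
From mathcomp Require Import all_boot all_order all_algebra.
From mathcomp Require Import all_classical all_reals all_analysis.
From mathcomp Require Import measurable_realfun.
Import Order.TTheory GRing.Theory Num.Theory.
Import numFieldNormedType.Exports.
Set Implicit Arguments.
Unset Strict Implicit.
Local Open Scope classical_set_scope.
Local Open Scope ring_scope.
Local Open Scope complex_scope.

(** * Densities: almost sure statements and expectations *)

Lemma has_density_integrable (R : realType) (d : measure_display)
    (T : measurableType d) (P : probability T R) (Y : T -> R) (f : R -> R) :
  has_density P Y f -> lebesgue_measure.-integrable setT (EFin \o f).
Proof.
move=> [mY mf f0 hf]; apply/integrableP; split; first exact/measurable_EFinP.
under eq_integral do rewrite /= ger0_norm//.
by rewrite -hf// preimage_setT probability_setT ltry.
Qed.

(** The law of [Y] is absolutely continuous with respect to Lebesgue measure, so preimages of null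
    sets are [P]-null. *)
Lemma has_density_ae (R : realType) (d : measure_display)
    (T : measurableType d) (P : probability T R) (Y : T -> R) (f : R -> R)
    (Q : R -> Prop) :
  has_density P Y f -> {ae lebesgue_measure, forall x, Q x} ->
  {ae P, forall t, Q (Y t)}.
Proof.
move=> [mY mf f0 hf] [N [mN N0 QN]]; exists (Y @^-1` N); split.
- by rewrite -[X in measurable X]setTI; exact: mY.
- by rewrite hf//; apply: null_set_integral => //; apply/measurable_EFinP;
    exact: measurable_funTS.
- by move=> t /= ?; exact: QN.
Qed.

(** The integral of [f] over its own zero set is 0, so [Y] almost surely avoids that set. *)
Lemma has_density_gt0 (R : realType) (d : measure_display)
    (T : measurableType d) (P : probability T R) (Y : T -> R) (f : R -> R) :
  has_density P Y f -> {ae P, forall t, 0 < f (Y t)}.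
Proof.
move=> [mY mf f0 hf].
have mE : measurable [set x | f x = 0].
  rewrite -[X in measurable X]setTI.
  exact: (mf measurableT [set 0] (measurable_set1 _)).
exists (Y @^-1` [set x | f x = 0]); split.
- by rewrite -[X in measurable X]setTI; exact: mY.
- by rewrite hf// integral0_eq// => x /= ->.
- by move=> t /= /negP; rewrite -leNgt => ft; apply/eqP; rewrite eq_le ft f0.
Qed.

(** Having the same integrals over all measurable sets, [f] and the Radon-Nikodym derivative of [nu]
    agree [mu]-almost everywhere; for the latter the change of measure is known. *)
Lemma ge0_integral_density (d : measure_display) (T : measurableType d)
    (R : realType) (nu : {finite_measure set T -> \bar R})
    (mu : {sigma_finite_measure set T -> \bar R}) (f phi : T -> R) :
  measurable_fun setT f -> (forall x, 0 <= f x) ->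
  (forall A, measurable A -> nu A = (\int[mu]_(x in A) (f x)%:E)%E) ->
  measurable_fun setT phi -> (forall x, 0 <= phi x) ->
  (\int[nu]_x (phi x)%:E = \int[mu]_x (phi x * f x)%:E)%E.
Proof.
move=> mf f0 nuf mphi phi0.
have mfE : measurable_fun setT (EFin \o f) by exact/measurable_EFinP.
have mphiE : measurable_fun setT (EFin \o phi) by exact/measurable_EFinP.
have numu : nu `<< mu.
  apply/null_content_dominatesP => A mA A0; rewrite nuf//.
  by apply: null_set_integral => //; exact: measurable_funTS.
have RNi := Radon_Nikodym_SigmaFinite.f_integrable numu.
rewrite -(Radon_Nikodym_SigmaFinite.change_of_variables numu)//.
under [RHS]eq_integral do rewrite EFinM.
apply: ae_eq_integral => //.
- by apply: emeasurable_funM => //; exact: measurable_int RNi.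
- by apply: emeasurable_funM.
- apply: ae_eqe_mul2l; apply: integral_ae_eq => //.
  by move=> A _ mA; rewrite -Radon_Nikodym_SigmaFinite.f_integral// nuf.
Qed.

Lemma ge0_expectation_density (R : realType) (d : measure_display)
    (T : measurableType d) (P : probability T R) (Y : T -> R) (f phi : R -> R) :
  has_density P Y f -> measurable_fun setT phi -> (forall x, 0 <= phi x) ->
  (\int[P]_t (phi (Y t))%:E = \int[lebesgue_measure]_x (phi x * f x)%:E)%E.
Proof.
move=> [mY mf f0 hf] mphi phi0.
pose Y_mfun := isMeasurableFun.Build _ _ T (measurableTypeR R) Y mY.
pose Y' : {RV P >-> measurableTypeR R} := HB.pack Y Y_mfun.
pose nu : {finite_measure set (measurableTypeR R) -> \bar R} :=
  distribution P Y'.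
rewrite -(@ge0_integral_density _ _ _ nu lebesgue_measure)//.
rewrite (@ge0_integral_distribution _ _ _ _ _ P Y' (EFin \o phi))//.
exact/measurable_EFinP.
Qed.

(** * Distribution functions and the almost sure relation between the densities *)

(** The distribution function is the integral of [f] over a half-line, hence has derivative [f]
    outside a Lebesgue-null set, which [Y] almost surely avoids. *)
Lemma has_density_is_derive_cdf (R : realType) (d : measure_display)
    (T : measurableType d) (P : probability T R) (Y : T -> R) (f : R -> R) :
  has_density P Y f ->
  {ae P, forall t,
    is_derive (Y t) 1 (fun y => fine (P (Y @^-1` `]-oo, y]))) (f (Y t))}.
Proof.
move=> hY; have [mY mf f0 hf] := hY.
have fi := has_density_integrable hY.
apply: (has_density_ae (Q := fun y =>
    is_derive y 1 (fun z => fine (P (Y @^-1` `]-oo, z]))) (f y)) hY).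
have := @FTC1Ny R f.
have fiy y : lebesgue_measure.-integrable `]-oo, y] (EFin \o f).
  exact: integrableS fi.
move=> /(_ fiy (open_integrable_locally openT fi)).
apply: filterS; first exact: (ae_filter_ringOfSetsType lebesgue_measure).
move=> x [dF F'x].
have -> : (fun z => fine (P (Y @^-1` `]-oo, z]))) =
    (fun z => \int[lebesgue_measure]_(t in `]-oo, z]) f t).
  by apply/funext => z; rewrite hf.
by apply: DeriveDef => //; rewrite -derive1E.
Qed.

Lemma measure_ae_iff (d : measure_display) (T : measurableType d)
    (R : realType) (mu : {measure set T -> \bar R}) (A B : set T) :
  measurable A -> measurable B -> {ae mu, forall t, A t <-> B t} ->
  mu A = mu B.
Proof.
move=> mA mB AB; rewrite -(setIT A) -(setIT B) -!integral_indic//.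
apply: ae_eq_integral => //; try exact/measurable_EFinP/measurable_indic.
apply: filterS AB => t AB _ /=; rewrite !indicE; congr (_%:R%:E).
by congr nat_of_bool; apply/idP/idP; rewrite !inE => /AB.
Qed.

Lemma has_density_ae_neq (R : realType) (d : measure_display)
    (T : measurableType d) (P : probability T R) (Y : T -> R) (f : R -> R)
    (c : R) :
  has_density P Y f -> {ae P, forall t, Y t != c}.
Proof.
move=> hY; apply: (has_density_ae (Q := fun y => y != c) hY).
exists [set c]; split; [exact: measurable_set1|exact: lebesgue_measure_set1|].
by move=> x /= /negP; rewrite negbK => /eqP.
Qed.

(** On [J] the distribution function of [X] is that of [zeta \o X] composed with [zeta]; the chain
    rule and uniqueness of the derivative give the relation. *)
Lemma has_density_ae_incr (R : realType) (d : measure_display)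
    (T : measurableType d) (P : probability T R) (X : T -> R)
    (f g zeta : R -> R) (J : set R) :
  has_density P X f -> has_density P (zeta \o X) g ->
  open J -> {ae P, forall t, J (X t)} ->
  (forall x, J x -> derivable zeta x 1) ->
  (forall x y, J x -> J y -> x < y -> zeta x < zeta y) ->
  {ae P, forall t, f (X t) = g (zeta (X t)) * derive1 zeta (X t)}.
Proof.
move=> hX hZ oJ XJ dz zI.
have [mX _ _ _] := hX; have [mZ _ _ _] := hZ.
have zle x y : J x -> J y -> (zeta x <= zeta y) = (x <= y).
  move=> Jx Jy; case: (ltgtP x y) => [/(zI _ _ Jx Jy)/ltW -> //| |->].
  - by move=> /(zI _ _ Jy Jx); rewrite ltNge => /negbTE.
  - by rewrite lexx.
have cdfE y : J y ->
    P (X @^-1` `]-oo, y]) = P ((zeta \o X) @^-1` `]-oo, zeta y]).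
  (* The two events agree only almost surely, since [zeta] is monotone on [J] alone. *)
  move=> Jy; apply: measure_ae_iff.
  - by rewrite -[X in measurable X]setTI; exact: mX.
  - by rewrite -[X in measurable X]setTI; exact: mZ.
  - by apply: filterS XJ => t JX; rewrite /= !in_itv/= zle.
have FX := has_density_is_derive_cdf hX.
have FZ := has_density_is_derive_cdf hZ.
apply: filterS3 XJ FX FZ => t JX dFX dFZ.
have dzX : is_derive (X t) 1 zeta (derive1 zeta (X t)).
  by rewrite derive1E; exact/derivableP/dz.
have dFzX := is_derive1_comp dFZ dzX.
rewrite -(@derive_val _ _ _ _ _ _ _ dFX).
apply: derive_val; apply: near_eq_is_derive dFzX.
(* The two functions are known to agree only on [J]; openness makes [J] a neighbourhood of [X t],
   which suffices for the derivative. *)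
have : \forall y \near X t, J y by exact: open_nbhs_nbhs.
by apply: filterS => y Jy; rewrite /= cdfE.
Qed.

(** A decreasing map exchanges lower and upper tails, so one distribution function is 1 minus the
    other composed with [zeta], whence the sign of the derivative. *)
Lemma has_density_ae_decr (R : realType) (d : measure_display)
    (T : measurableType d) (P : probability T R) (X : T -> R)
    (f g zeta : R -> R) (J : set R) :
  has_density P X f -> has_density P (zeta \o X) g ->
  open J -> {ae P, forall t, J (X t)} ->
  (forall x, J x -> derivable zeta x 1) ->
  (forall x y, J x -> J y -> x < y -> zeta y < zeta x) ->
  {ae P, forall t, f (X t) = g (zeta (X t)) * - derive1 zeta (X t)}.
Proof.
move=> hX hZ oJ XJ dz zD.
have [mX _ _ _] := hX; have [mZ _ _ _] := hZ.
have zle x y : J x -> J y -> (zeta y <= zeta x) = (x <= y).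
  move=> Jx Jy; case: (ltgtP x y) => [/(zD _ _ Jx Jy)/ltW -> //| |->].
  - by move=> /(zD _ _ Jy Jx); rewrite ltNge => /negbTE.
  - by rewrite lexx.
have mZy y : measurable ((zeta \o X) @^-1` `]-oo, y]).
  by rewrite -[X in measurable X]setTI; exact: mZ.
have cdfE y : J y -> fine (P (X @^-1` `]-oo, y])) =
    1 - fine (P ((zeta \o X) @^-1` `]-oo, zeta y])).
  move=> Jy; rewrite -[1]/(fine 1%E) -fineB ?fin_num_measure//.
  rewrite -probability_setC//; congr fine; apply: measure_ae_iff.
  - by rewrite -[X in measurable X]setTI; exact: mX.
  - exact: measurableC.
  (* The complement is a strict tail, whereas [X <= y] yields a weak one; they agree almost surely
     because [zeta \o X] has no atom at [zeta y]. *)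
  - have Zy := has_density_ae_neq (zeta y) hZ.
    apply: filterS2 XJ Zy => t JX /= Zy; rewrite /= !in_itv/= -(zle _ _ JX Jy).
    by rewrite [X in is_true X <-> _]le_eqVlt eq_sym (negbTE Zy)/= ltNge;
      split => /negP.
have FX := has_density_is_derive_cdf hX.
have FZ := has_density_is_derive_cdf hZ.
apply: filterS3 XJ FX FZ => t JX dFX dFZ.
have dzX : is_derive (X t) 1 zeta (derive1 zeta (X t)).
  by rewrite derive1E; exact/derivableP/dz.
have dFzX :=
  is_deriveB (is_derive_cst (1 : R) (X t) 1) (is_derive1_comp dFZ dzX).
rewrite mulrN -[RHS]sub0r.
rewrite -(@derive_val _ _ _ _ _ _ _ dFX).
apply: derive_val; apply: near_eq_is_derive dFzX.
have : \forall y \near X t, J y by exact: open_nbhs_nbhs.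
by apply: filterS => y Jy; rewrite cdfE.
Qed.

(** * Transport of the integral through expectations *)

(** The derivative is the pointwise limit of difference quotients with steps [1/(n+1)]. Extending
    [zeta] by 0 outside [J] makes each quotient measurable, even when the shifted point leaves
    [J]. *)
Lemma measurable_fun_derive1 (R : realType) (J : set R) (zeta : R -> R) :
  open J -> (forall x, J x -> derivable zeta x 1) ->
  measurable_fun J (derive1 zeta).
Proof.
move=> oJ dz.
have mJ : measurable J by exact: open_measurable.
have mz : measurable_fun J zeta.
  apply: open_continuous_measurable_fun => // x /set_mem Jx.
  exact/differentiable_continuous/derivable1_diffP/dz.
have mzJ : measurable_fun setT (zeta \_ J).
  exact/(measurable_restrictT _ _).1.
pose h n x := n.+1%:R * ((zeta \_ J) (n.+1%:R^-1 + x) - zeta x).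
apply: (@measurable_fun_cvg _ _ _ _ h).
- move=> n; apply: measurable_funM => //; apply: measurable_funB => //.
  apply: measurable_funTS; apply: measurableT_comp => //.
  exact: measurable_funD.
- move=> x Jx.
  have /cvg_ex[l dzl] := dz _ Jx.
  have -> : derive1 zeta x = l.
    by rewrite derive1E; apply/cvg_lim.
  (* For large [n] the shifted point lies in the open set [J], so the extension by 0 does not affect
     the limit. *)
  have Jxn : \forall n \near \oo, J (n.+1%:R^-1 + x).
    have cx : harmonic n + x @[n --> \oo] --> 0 + x.
      by apply: cvgD; [exact: cvg_harmonic|exact: cvg_cst].
    by rewrite add0r in cx; apply: cx; exact: open_nbhs_nbhs.
  have n0 (n : nat) : @harmonic R n != 0 by rewrite invr_eq0 pnatr_eq0.
  have := (cvgr_dnbhsP _ _ _).1 dzl _ (conj n0 cvg_harmonic).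
  apply: cvg_trans; apply: near_eq_cvg; apply: filterS Jxn => n Jxn.
  by rewrite /h patchE mem_set//= /harmonic invrK [_ *: 1]mulr1.
Qed.

(** At [x = 0] exponents may be added as long as their sum [b] is nonzero. *)
Lemma powR_subr1M (R : realType) (x b : R) :
  0 <= x -> 1 <= b -> x `^ b = x `^ (b - 1) * x.
Proof.
move=> x0 b1; have b0 : b != 0 by rewrite gt_eqF// (lt_le_trans _ b1).
by rewrite -{3}(powRr1 x0) -powRD subrK// (negbTE b0).
Qed.

(** The absolute value of the derivative lets both monotone cases share this computation. Requiring
    [0 < zeta x] in [D] costs nothing, as [zeta \o X] has no atom at 0. *)
Lemma integral_density_transport (R : realType) (d : measure_display)
    (T : measurableType d) (P : probability T R) (X : T -> R)
    (f g omega zeta : R -> R) (beta : R) (J : set R) :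
  has_density P X f -> has_density P (zeta \o X) g ->
  open J -> {ae P, forall t, J (X t)} ->
  (forall x, J x -> derivable zeta x 1) ->
  {ae P, forall t, 0 <= zeta (X t)} ->
  {ae P, forall t, f (X t) = g (zeta (X t)) * `|derive1 zeta (X t)|} ->
  measurable_fun (`[0, +oo[ : set R) omega ->
  (forall u : R, 0 <= u -> 0 <= omega u) -> 1 <= beta ->
  let D := [set x | J x /\ 0 < zeta x] in
  let h x := omega (zeta x) * f x `^ beta / `|derive1 zeta x| `^ (beta - 1) in
  [/\ measurable D, measurable_fun D h, forall x, D x -> 0 <= h x &
  (\int[lebesgue_measure]_(x in D) (h x)%:E =
   \int[lebesgue_measure]_(u in `[0%R, +oo[) (omega u * g u `^ beta)%:E)%E].
Proof.
move=> hX hZ oJ XJ dz Z0 fgX momega omega0 b1 D h.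
have [mX mf f0 _] := hX; have [mZ mg g0 _] := hZ.
have mJ : measurable J by exact: open_measurable.
have mz : measurable_fun J zeta.
  apply: open_continuous_measurable_fun => // x /set_mem Jx.
  exact/differentiable_continuous/derivable1_diffP/dz.
have DE : D = J `&` zeta @^-1` `]0, +oo[.
  by apply/seteqP; split => x /=; rewrite in_itv/= andbT.
have mD : measurable D by rewrite DE; exact: mz.
have DJ : D `<=` J by move=> x [].
have mzD : measurable_fun D zeta by exact: measurable_funS mz.
have mdzD : measurable_fun D (derive1 zeta).
  by apply: (measurable_funS mJ) => //; exact: measurable_fun_derive1.
have momegaz : measurable_fun D (omega \o zeta).
  apply: (@measurable_comp _ _ _ _ _ _ (`[0%R, +oo[%classic : set R)
    omega _ zeta _ _ momega mzD).
    exact: measurable_itv.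
  by move=> _ [x [_ /ltW zx] <-]; rewrite /= in_itv/= andbT.
pose phi x := omega (zeta x) * f x `^ (beta - 1) *
  `|derive1 zeta x| `^ (- (beta - 1)).
pose psi u := omega u * g u `^ (beta - 1).
have mphi : measurable_fun D phi.
  apply: measurable_funM; first apply: measurable_funM => //.
  -
    exact: (measurableT_comp (measurable_powR (beta - 1))
      (measurable_funTS mf)).
  - apply: (measurableT_comp (measurable_powR _)).
    exact: measurableT_comp.
have mpsi : measurable_fun (`[0, +oo[ : set R) psi.
  apply: measurable_funM => //.
  apply: (measurableT_comp (measurable_powR _)).
  exact: measurable_funTS.
(* This also holds where the derivative vanishes, since the inverse of 0 is 0 on both sides. *)
have hE x : h x = phi x * f x.
  by rewrite /h /phi powRN (powR_subr1M (f0 x) b1) mulrA mulrAC.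
have phi0 x : D x -> 0 <= phi x.
  by move=> [_ /ltW zx]; rewrite !mulr_ge0 ?powR_ge0 ?omega0.
split => //.
- apply: (eq_measurable_fun (fun x => phi x * f x)) => [x _|].
    by rewrite hE.
  by apply: measurable_funM => //; exact: measurable_funTS.
- by move=> x Dx; rewrite hE mulr_ge0 ?phi0.
have mitv : measurable (`[0, +oo[ : set R) by exact: measurable_itv.
transitivity (\int[P]_t ((phi \_ D) (X t))%:E)%E.
  rewrite (ge0_expectation_density hX)//; last 2 first.
  - exact/(measurable_restrictT _ _).1.
  - by move=> x; rewrite patchE; case: ifPn => // /set_mem/phi0.
  rewrite integral_mkcond; apply: eq_integral => x _.
  by rewrite !patchE; case: ifPn; rewrite ?hE ?mul0r.
transitivity (\int[P]_t ((psi \_ `[0, +oo[) (zeta (X t)))%:E)%E.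
  have mphiX : measurable_fun setT ((phi \_ D) \o X).
    by apply: measurableT_comp => //; exact/(measurable_restrictT _ _).1.
  have mpsiZ : measurable_fun setT ((psi \_ `[0, +oo[) \o (zeta \o X)).
    by apply: measurableT_comp => //; exact/(measurable_restrictT _ _).1.
  apply: ae_eq_integral => //; try exact/measurable_EFinP.
  have X_gt0 := has_density_gt0 hX.
  have Z_neq0 := has_density_ae_neq 0 hZ.
  near=> t => _.
  have ft : 0 < f (X t) by near: t.
  have ftE : f (X t) = g (zeta (X t)) * `|derive1 zeta (X t)| by near: t.
  have Jt : J (X t) by near: t.
  have z_ge0 : 0 <= zeta (X t) by near: t.
  have z_neq0 : zeta (X t) != 0 by near: t.
  have z_gt0 : 0 < zeta (X t) by rewrite lt_neqAle eq_sym z_neq0.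
  (* A zero derivative would force [f (X t) = 0], which almost surely does not happen. *)
  have dz_gt0 : 0 < `|derive1 zeta (X t)|.
    rewrite lt_neqAle normr_ge0 andbT eq_sym; apply/eqP => dz0.
    by move: ft; rewrite ftE dz0 mulr0 ltxx.
  congr EFin; rewrite !patchE !mem_set//=; last by rewrite in_itv/= andbT.
  rewrite /phi /psi -mulrA; congr (_ * _).
  by rewrite ftE powRM// powRN mulfK// gt_eqF// powR_gt0.
rewrite (ge0_expectation_density hZ)//; last 2 first.
- exact/(measurable_restrictT _ _).1.
- move=> u; rewrite patchE; case: ifPn => // /set_mem/=.
  by rewrite in_itv/= andbT => u0; rewrite mulr_ge0 ?powR_ge0 ?omega0.
rewrite [RHS]integral_mkcond; apply: eq_integral => u _.
rewrite !patchE; case: ifPn => _; rewrite ?mul0r//.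
by rewrite (powR_subr1M (g0 u) b1) mulrA.
Unshelve. all: end_near. Qed.

(** * The interval of integration *)

Lemma open_bracket (R : realType) (D : set R) (x : R) :
  open D -> D x -> exists a b, [/\ D a, D b & a < x < b].
Proof.
move=> oD Dx.
have /nbhs_ballP[e /= e0 xe] : nbhs x D by exact: open_nbhs_nbhs.
have e2 : 0 < e / 2 by rewrite divr_gt0.
have e2e : e / 2 < e by rewrite ltr_pdivrMr// ltr_pMr// ltr1n.
exists (x - e / 2), (x + e / 2); split.
- by apply: xe; rewrite /ball/= opprB addrCA subrr addr0 gtr0_norm.
- by apply: xe; rewrite /ball/= opprD addNKr normrN gtr0_norm.
- by rewrite ltrBlDr !ltrDl e2.
Qed.

Lemma open_preimage_gt0 (R : realType) (J : set R) (zeta : R -> R) :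
  open J -> (forall x, J x -> derivable zeta x 1) ->
  open [set x | J x /\ 0 < zeta x].
Proof.
move=> oJ dz; rewrite openE => x [Jx zx].
have cz : {for x, continuous zeta}.
  exact/differentiable_continuous/derivable1_diffP/dz.
have zpos : \forall y \near x, 0 < zeta y.
  by apply: (cz [set u | 0 < u]); exact: open_nbhs_nbhs.
have Jpos : \forall y \near x, J y by exact: open_nbhs_nbhs.
exact: filterS2 Jpos zpos.
Qed.

(** The set on the right is open, so each of its points lies strictly between two others; this
    yields the strict inequalities at both ends, whether or not 0 is a value of [zeta]. *)
Lemma between_inv_incr (R : realType) (J : set R) (zeta : R -> R) :
  open J -> is_interval J -> (forall x, J x -> derivable zeta x 1) ->
  (forall x y, J x -> J y -> x < y -> zeta x < zeta y) ->
  between (inv_incr J zeta 0%E) (inv_incr J zeta +oo%E) =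
  [set x | J x /\ 0 < zeta x].
Proof.
move=> oJ iJ dz zI.
have le_inv : (inv_incr J zeta 0 <= inv_incr J zeta +oo)%E.
  apply: le_ereal_sup => z [->|[t [Jt _] <-]]; first by left.
  by right; exists t => //; split => //; rewrite leey.
rewrite /between (min_idPl le_inv) (max_idPr le_inv).
apply/seteqP; split => x /=.
- move=> /andP[lx xr].
  have infx : (ereal_inf (EFin @` J) < x%:E)%E.
    by apply: le_lt_trans lx; apply: ereal_sup_ubound; left.
  have /ereal_inf_lt[_ [s Js <-]] := infx; rewrite lte_fin => sx.
  have [t Jt xt] : exists2 t, J t & x < t.
    have /ereal_sup_gt[_ [->|[t [Jt _] <-]]] := xr.
      by rewrite ltNge (ltW infx).
    by rewrite lte_fin; exists t.
  have Jx : J x by apply: (iJ s t) => //; rewrite (ltW sx) (ltW xt).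
  (* If [zeta x <= 0], then [x] belongs to the set whose supremum is the inverse at 0, contradicting
     [lx]. *)
  split => //; rewrite ltNge; apply/negP => zx0.
  move: lx; rewrite ltNge => /negP; apply.
  by apply: ereal_sup_ubound; right; exists x => //; split => //;
    rewrite lee_fin.
- move=> /(open_bracket (open_preimage_gt0 oJ dz)).
  move=> [a [b [[Ja za] [Jb zb] /andP[ax xb]]]].
  apply/andP; split.
  + apply: (@le_lt_trans _ _ a%:E); last by rewrite lte_fin.
    apply: ge_ereal_sup => z [->|[t [Jt]]].
      by apply: ereal_inf_lbound; exists a.
    rewrite lee_fin => zt0 <-; rewrite lee_fin leNgt; apply/negP.
    by move=> /(zI _ _ Ja Jt)/lt_le_trans/(_ zt0); rewrite ltNge (ltW za).
  + apply: (@lt_le_trans _ _ b%:E); first by rewrite lte_fin.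
    by apply: ereal_sup_ubound; right; exists b => //; split => //;
      rewrite leey.
Qed.

Lemma between_inv_decr (R : realType) (J : set R) (zeta : R -> R) :
  open J -> is_interval J -> (forall x, J x -> derivable zeta x 1) ->
  (forall x y, J x -> J y -> x < y -> zeta y < zeta x) ->
  between (inv_decr J zeta 0%E) (inv_decr J zeta +oo%E) =
  [set x | J x /\ 0 < zeta x].
Proof.
move=> oJ iJ dz zD.
(* No real value reaches [+oo], so only the lower end of [J] remains in the supremum. *)
have invy : inv_decr J zeta +oo = ereal_inf (EFin @` J).
  rewrite /inv_decr (_ : [set x | _] = set0) ?image_set0 ?setU0 ?ereal_sup1//.
  by apply/seteqP; split => // t [_]; rewrite leye_eq.
have le_inv : (inv_decr J zeta +oo <= inv_decr J zeta 0)%E.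
  by rewrite invy; apply: ereal_sup_ubound; left.
rewrite /between (min_idPr le_inv) (max_idPl le_inv) invy.
apply/seteqP; split => x /=.
- move=> /andP[infx xr].
  have /ereal_inf_lt[_ [s Js <-]] := infx; rewrite lte_fin => sx.
  have /ereal_sup_gt[_ [->|[t [Jt zt] <-]]] := xr.
    by rewrite ltNge (ltW infx).
  rewrite lte_fin => xt.
  have Jx : J x by apply: (iJ s t) => //; rewrite (ltW sx) (ltW xt).
  by split => //; apply: le_lt_trans (zD _ _ Jx Jt xt); rewrite -lee_fin.
- move=> /(open_bracket (open_preimage_gt0 oJ dz)).
  move=> [a [b [[Ja za] [Jb zb] /andP[ax xb]]]].
  apply/andP; split.
  + apply: (@le_lt_trans _ _ a%:E); last by rewrite lte_fin.
    by apply: ereal_inf_lbound; exists a.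
  + apply: (@lt_le_trans _ _ b%:E); first by rewrite lte_fin.
    by apply: ereal_sup_ubound; right; exists b => //; split => //;
      rewrite lee_fin ltW.
Qed.

(** * Complex powers and the two formulas *)

Lemma cpowN1 (R : realType) (a : R) :
  cpow (-1) a = cos (a * pi) +i* sin (a * pi).
Proof. by rewrite /cpow ltrN10 normrN1 powR1 mul1r. Qed.

(** The inverse of a complex number of modulus 1 is its conjugate. At [x = 0] either [a = 0] and
    both sides are 1, or both vanish. *)
Lemma cpow_npos_inv (R : realType) (x a : R) : x <= 0 ->
  (cpow x a)^-1 = (`|x| `^ a)^-1%:C * (cos (a * pi) -i* sin (a * pi)).
Proof.
rewrite le_eqVlt /cpow => /predU1P[->|x0]; last first.
  rewrite x0 invfM -fmorphV/=; congr (_ * _).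
  by apply/eqP; rewrite eq_complex/= cos2Dsin2 !divr1 !eqxx.
rewrite ltxx mulr1 normr0 -fmorphV/=.
have [->|a0] := eqVneq a 0; first by rewrite mul0r cos0 sin0 oppr0 mulr1.
by rewrite powR0// invr0 mul0r.
Qed.

Theorem theorem2p3 (R : realType) (d : measure_display) (T : measurableType d)
    (P : probability T R) (X : T -> R) (f g omega zeta : R -> R) (beta : R)
    (J : set R)
    (* X is non-negative with density f, and takes its values in the open
       interval J on which zeta is defined *)
    (hX : has_density P X f)
    (X_ge0 : {ae P, forall t, 0 <= X t})
    (J_open : open J) (J_itv : is_interval J)
    (X_in_J : {ae P, forall t, J (X t)})
    (* zeta is differentiable and invertible on J *)
    (zeta_diff : forall x, J x -> derivable zeta x 1)
    (zeta_inj : forall x y, J x -> J y -> zeta x = zeta y -> x = y)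
    (* zeta(X) is non-negative with density g *)
    (hZ : has_density P (zeta \o X) g)
    (Z_ge0 : {ae P, forall t, 0 <= zeta (X t)})
    (omega_meas : measurable_fun (`[0, +oo[ : set R) omega)
    (omega_ge0 : forall u : R, 0 <= u -> 0 <= omega u)
    (beta_ge1 : 1 <= beta)
    (hI : gwigf_exists omega beta g) :
  ((forall x y, J x -> J y -> x < y -> zeta x < zeta y) ->
     gwigf omega beta g =
     \int[lebesgue_measure]_(x in between (inv_incr J zeta 0%E)
                                          (inv_incr J zeta +oo%E))
       (omega (zeta x) * f x `^ beta / (derive1 zeta x) `^ (beta - 1)))
  /\
  ((forall x y, J x -> J y -> x < y -> zeta y < zeta x) ->
     (gwigf omega beta g)%:C =
     cpow (-1) (beta - 1) *
     cintegral (between (inv_decr J zeta 0%E) (inv_decr J zeta +oo%E))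
       (fun x => (omega (zeta x) * f x `^ beta)%:C /
                 cpow (derive1 zeta x) (beta - 1))).

Proof.
have transport :=
  integral_density_transport hX hZ J_open X_in_J zeta_diff Z_ge0.
have J_int : J° = J by exact/interior_id.
split=> mono.
(* Strict monotonicity gives only a weak sign, which is enough to remove the absolute value. *)
- have dz_ge0 x : J x -> 0 <= derive1 zeta x.
    move=> Jx; apply: (incr_derive1_ge0 (D := J)); rewrite ?J_int//.
    + by move=> y /set_mem; exact: zeta_diff.
    + by move=> y z /set_mem Jy /set_mem Jz; exact: mono.
  have fgX : {ae P, forall t, f (X t) = g (zeta (X t)) * `|derive1 zeta (X t)|}.
    have := has_density_ae_incr hX hZ J_open X_in_J zeta_diff mono.
    by apply: filterS2 X_in_J => t Jt ->; rewrite ger0_norm ?dz_ge0.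
  have [_ _ _ hE] := transport _ _ fgX omega_meas omega_ge0 beta_ge1.
  rewrite between_inv_incr// /gwigf /Rintegral -hE; congr fine.
  by apply: eq_integral => x /set_mem[Jx _]; rewrite ger0_norm ?dz_ge0.
- have dz_le0 x : J x -> derive1 zeta x <= 0.
    move=> Jx; apply: (decr_derive1_le0 (D := J)); rewrite ?J_int//.
    + by move=> y /set_mem; exact: zeta_diff.
    + by move=> y z /set_mem Jy /set_mem Jz; exact: mono.
  have fgX : {ae P, forall t, f (X t) = g (zeta (X t)) * `|derive1 zeta (X t)|}.
    have := has_density_ae_decr hX hZ J_open X_in_J zeta_diff mono.
    by apply: filterS2 X_in_J => t Jt ->; rewrite ler0_norm ?dz_le0.
  have [mD mh h0 hE] := transport _ _ fgX omega_meas omega_ge0 beta_ge1.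
  rewrite between_inv_decr//.
  move: mD mh h0 hE; set D := [set x | _]; move=> mD.
  set h := fun x => omega (zeta x) * f x `^ beta / _; move=> mh h0 hE.
  (* Integrability passes from [hI] through the equality [hE] of nonnegative integrals; it is needed
     below to pull constants out of the real and imaginary integrals. *)
  have hint : lebesgue_measure.-integrable D (EFin \o h).
    apply/integrableP; split; first exact/measurable_EFinP.
    under eq_integral => x /set_mem Dx do rewrite /= ger0_norm ?h0//.
    rewrite hE; have /integrableP[_] := hI.
    congr (_ < _)%E; apply: eq_integral => u /set_mem/=.
    rewrite in_itv/= andbT => u0; rewrite ger0_norm//.
    by rewrite mulr_ge0 ?powR_ge0 ?omega_ge0.
  have gE : gwigf omega beta g = \int[lebesgue_measure]_(x in D) h x.
    by rewrite /gwigf /Rintegral -hE.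
  set c := cos ((beta - 1) * pi); set s := sin ((beta - 1) * pi).
  (* The complex integrand is the real function [h] times the constant phase [c - i s]. *)
  have kE x : x \in D -> (omega (zeta x) * f x `^ beta)%:C /
      cpow (derive1 zeta x) (beta - 1) = (h x * c) +i* (h x * - s).
    move=> /set_mem[Jx _]; rewrite cpow_npos_inv ?dz_le0// mulrA -rmorphM/=.
    by apply/eqP; rewrite eq_complex/= !mul0r subr0 addr0 !eqxx.
  have -> : cintegral D (fun x => (omega (zeta x) * f x `^ beta)%:C /
        cpow (derive1 zeta x) (beta - 1)) =
      (\int[lebesgue_measure]_(x in D) (h x * c)) +i*
      (\int[lebesgue_measure]_(x in D) (h x * - s)).
    by congr (_ +i* _); apply: eq_Rintegral => x /kE kxE;
      [exact: (congr1 (@complex.Re R) kxE)|exact: (congr1 (@complex.Im R) kxE)].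
  rewrite !RintegralZr// -gE cpowN1 -/c -/s.
  (* The outer factor [c + i s] cancels the phase: the real part uses [c^2 + s^2 = 1], and the cross
     terms of the imaginary part cancel. *)
  apply/eqP; rewrite eq_complex/=; apply/andP; split; apply/eqP.
  + rewrite mulrN mulrN opprK mulrCA [s * _]mulrCA -mulrDr -!expr2.
    by rewrite cos2Dsin2 mulr1.
  + by rewrite mulrN mulrN mulrCA [s * _]mulrCA [s * c]mulrC addNr.
Qed.
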